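(* Let $D>0$ and $\rho>1$. Let $F:[0,+\infty)\to[0,+\infty)$ be a non-decreasing function. Assume that $F(x)=0$ if $x\le2\rho$. Let $\mu$ be a probability measure on $\mathbb R^n$ such that every Borel $A\subset\mathbb R^n$ with $\mu(A)\le1/(2\rho)<1/2$ satisfies $$\mu(A)\,F\left(\frac{\rho}{\mu(A)}\right)\le D\,\mathrm{Cap}_\mu(A).$$ Then for every smooth $f:\mathbb R^n\to\mathbb R$ one has $$\int f^2F\left(\frac{f^2}{\int f^2d\mu}\right)d\mu\le D\left(\frac{\rho}{\sqrt\rho-1}\right)^2\int|\nabla f|^2d\mu .$$
   Context: For a probability measure $\mu$ on $\mathbb R^n$ and a Borel set $A$ with $\mu(A)\le1/2$, $$\mathrm{Cap}_\mu(A)=\inf\left\{\int|\nabla f|^2d\mu:\ f \text{ locally Lipschitz},\ f_{|A}\ge1,\ \mu(f=0)\ge\tfrac12\right\}.$$ Measures are taken absolutely continuous with respect to Lebesgue measure when dealing with capacities. *)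

(* Defs.v *)
From HB Require Import structures.
From mathcomp Require Export all_boot all_order all_algebra.
From mathcomp Require Export all_classical all_reals all_analysis.
Export Order.TTheory GRing.Theory Num.Theory.
Export numFieldNormedType.Exports.

Set Implicit Arguments.
Unset Strict Implicit.
Unset Printing Implicit Defensive.

Local Open Scope classical_set_scope.
Local Open Scope ring_scope.
Local Open Scope ereal_scope.

(* R^n with its Borel sigma-algebra; as a type it is convertible to 'rV[R]_n.
   The norm of 'rV[R]_n is the sup norm: this affects neither its topology nor
   the notions of local Lipschitz continuity and differentiability. *)
Definition borelRn (R : realType) (n : nat) :=
  g_sigma_algebraType (@open 'rV[R]_n).

Section euclidean.
Context (R : realType) (n : nat).
Implicit Types (f : 'rV[R]_n -> R) (x a b : 'rV[R]_n) (A : set 'rV[R]_n).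

Definition partial (i : 'I_n) f : 'rV[R]_n -> R :=
  fun x => 'D_(delta_mx ord0 i) f x.

(* C^infinity: all iterated partial derivatives, including f itself (the empty
   list of indices), are differentiable everywhere. *)
Definition smooth f :=
  forall (s : seq 'I_n) x, differentiable (foldr partial f s) x.

Definition locally_lipschitz f :=
  forall x, exists2 U : set 'rV[R]_n, nbhs x U & [lipschitz f y | y in U].

(* The gradient is set to 0 where f is not differentiable. For f locally
   Lipschitz this is a Lebesgue-null set (Rademacher), hence a mu-null set for
   every mu absolutely continuous with respect to Lebesgue measure. *)
Definition grad f x : 'rV[R]_n :=
  if `[< differentiable f x >] then \row_i partial i f x else 0%R.

(* The square of the Euclidean norm of the gradient, `|grad f x| being the
   sup norm. *)
Definition sqnorm_grad f x : R := (\sum_(i < n) grad f x ord0 i ^+ 2)%R.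

Definition box a b : set 'rV[R]_n :=
  [set x | forall i : 'I_n, (a ord0 i <= x ord0 i <= b ord0 i)%R].

Definition box_volume a b : R :=
  (\prod_(i < n) Num.max 0 (b ord0 i - a ord0 i))%R.

(* n-dimensional Lebesgue outer measure: infimum of the total volume over the
   countable covers by closed boxes. *)
Definition lebesgue_outer A : \bar R :=
  ereal_inf [set v | exists (I : set nat) (a b : nat -> 'rV[R]_n),
    A `<=` \bigcup_(k in I) box (a k) (b k) /\
    v = \esum_(k in I) (box_volume (a k) (b k))%:E].

Definition capacity (mu : probability (borelRn R n) R)
    (A : set (borelRn R n)) : \bar R :=
  ereal_inf [set v | exists f,
    [/\ locally_lipschitz f,
        (forall x, A x -> (1 <= f x)%R),
        (2^-1)%:E <= mu [set x | f x = 0%R] &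
        v = \int[mu]_x (sqnorm_grad f x)%:E]].

End euclidean.

(* Main.v *)
Require Import Defs.
From mathcomp Require Import measurable_realfun ring lra.

Local Open Scope classical_set_scope.
Local Open Scope ring_scope.

(** Write S for the integral of f ^+ 2. When S is 0 or infinite, the left-hand
    side vanishes. Otherwise, cut R^n along the levels u_j of |f| defined by
    u_j ^+ 2 = 2 S rho ^+ j. Since F vanishes up to 2 rho, only the points with
    |f| > u_1 contribute to the left-hand side, and on u_(j+1) < |f| <= u_(j+2)
    the integrand is at most 2 S rho ^+ j.+2 * F (2 rho ^+ j.+2), because F is
    nondecreasing.

    Markov's inequality bounds the measure m of {|f| > u_(j+1)} by
    (2 rho ^+ j.+1)^-1. If m > 0, then 2 rho ^+ j.+2 <= rho / m, and the
    contribution of the shell is controlled by m F (rho / m), that is, by the capacity of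
    {|f| > u_(j+1)}. This capacity is tested with the truncation of |f| between
    u_j and u_(j+1), which is admissible because |f| <= u_j holds with
    probability at least 1/2 (capacity_superlevel_le). Its energy is the
    energy of f on the shell u_j < |f| < u_(j+1), divided by
    (u_(j+1) - u_j) ^+ 2 = 2 S rho ^+ j (sqrt rho - 1) ^+ 2. The constants
    combine into one that does not depend on j (shell_le), and the shells are
    disjoint, so summing over j gives the theorem.

    The analytic core is sqnorm_grad_ramp_le: the gradient of a truncation
    vanishes at every point outside the open shell, including the points where
    |f| equals one of the two levels, since the truncation has a global extremum
    there. The energy is thus compared pointwise, and not only almost
    everywhere. *)

(** * Differential calculus *)

(** The directional derivative is the ordinary derivative along a line; this is
    what lets the one-variable mean value theorem act on segments. *)
Lemma is_derive_line (R : realType) (V W : normedModType R) (f : V -> W)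
    (z v : V) (t : R) : derivable f (z + t *: v) v ->
  is_derive t 1 (fun s : R => f (z + s *: v)) ('D_v f (z + t *: v)).
Proof.
have quotE : (fun h : R => h^-1 *:
      (((fun s : R => f (z + s *: v)) \o shift t) (h *: 1) - f (z + t *: v))) =
    (fun h : R => h^-1 *: ((f \o shift (z + t *: v)) (h *: v) - f (z + t *: v))).
  apply/funext => h /=; congr (_ *: (f _ - _)).
  by rewrite [h *: 1]mulr1 scalerDl addrCA.
by move=> dfv; split; rewrite /derivable /derive quotE.
Qed.

Section extrema.
Context (R : realType) (V : normedModType R).
Implicit Types (f : V -> R) (x v : V).

(** Difference quotients with positive increments are nonnegative at a minimum.
    Only derivability at the point itself is assumed, since a truncated function
    may fail to be differentiable arbitrarily close to it. *)
Lemma derive_ge0_at_min f x v : derivable f x v ->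
  (forall y, f x <= f y) -> 0 <= 'D_v f x.
Proof.
move=> dfv fmin; rewrite ['D_v f x]cvg_at_rightE; last exact: dfv.
apply: limr_ge.
  rewrite -(cvg_at_rightE (fun h : R => h^-1 *: ((f \o shift x) (h *: v) - f x))) //.
  apply: cvg_trans dfv; apply: cvg_app.
  move=> A [e egt0 Ae]; exists e => // y xe xgt0; apply: Ae => //.
  exact/lt0r_neq0.
near=> h; apply: mulr_ge0; last by rewrite subr_ge0; exact: fmin.
by rewrite invr_ge0; apply: ltW; near: h; exists 1 => /=.
Unshelve. all: by end_near. Qed.

(** Apply the one-sided bound to v and to - v: the differential is odd. *)
Lemma derive_min f x v : differentiable f x ->
  (forall y, f x <= f y) -> 'D_v f x = 0.
Proof.
move=> dfx fmin; apply/eqP; rewrite eq_le derive_ge0_at_min ?andbT //.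
  have := derive_ge0_at_min _ _ _ (diff_derivable (v := - v) dfx) fmin.
  by rewrite !deriveE // linearN oppr_ge0.
exact: diff_derivable.
Qed.

Lemma derive_max f x v : differentiable f x ->
  (forall y, f y <= f x) -> 'D_v f x = 0.
Proof.
move=> dfx fmax; apply/oppr_inj; rewrite oppr0 -deriveN; last exact: diff_derivable.
by apply: derive_min => [|y]; [exact: differentiableN|rewrite lerN2].
Qed.

End extrema.

Section smooth.
Context (R : realType) (n : nat).
Implicit Types (f : 'rV[R]_n -> R) (x : 'rV[R]_n).

Lemma smooth_differentiable f x : smooth f -> differentiable f x.
Proof. by move=> /(_ [::] x). Qed.

Lemma smooth_continuous f : smooth f -> continuous f.
Proof.
by move=> fs x; apply: differentiable_continuous; exact: smooth_differentiable.
Qed.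

Lemma smooth_continuous_partial f i : smooth f -> continuous (partial i f).
Proof.
by move=> fs x; apply: differentiable_continuous; exact: (fs [:: i] x).
Qed.

Lemma derive_partial f x v : differentiable f x ->
  'D_v f x = \sum_(i < n) v ord0 i * partial i f x.
Proof.
move=> dfx; rewrite deriveE // {1}[v]row_sum_delta linear_sum /=.
by apply: eq_bigr => i _; rewrite linearZ /partial deriveE.
Qed.

Lemma ler_coord_norm x i : `|x ord0 i| <= `|x|.
Proof.
rewrite [leRHS]/Num.Def.normr /= mx_normrE.
exact: (le_bigmax _ (fun ij => `|x ij.1 ij.2|) (ord0, i)).
Qed.

(** On a small ball the partial derivatives are bounded, by continuity, and the
    ball is convex: the mean value theorem on the segment between two of its
    points makes the sum of these bounds a Lipschitz constant. *)
Lemma locally_lipschitz_smooth f : smooth f -> locally_lipschitz f.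
Proof.
move=> fs x.
pose M := \sum_(i < n) (`|partial i f x| + 1).
have : \forall y \near x, forall i : 'I_n, `|partial i f y| <= `|partial i f x| + 1.
  apply: (@filter_forall _ _ (fun i y => `|partial i f y| <= `|partial i f x| + 1)
    (nbhs x) (nbhs_filter x)) => i.
  have := smooth_continuous_partial f i fs x.
  move=> /cvgr_dist_le /(_ _ ltr01); apply: filterS => y dxy.
  rewrite -(subrK (partial i f x) (partial i f y)) (le_trans (ler_normD _ _)) //.
  by rewrite addrC lerD2l distrC.
move=> /nbhs_ballP[r r0 xr]; exists (ball x r); first exact: nbhsx_ballx.
apply: (@klipschitzW _ _ _ M).
  exact: (@globally_properfilter _ _ (x, x)) (conj (ballxx _ _) (ballxx _ _)).
move=> [y z] [/= xy xz].
have df t := @diff_derivable _ _ _ f (z + t *: (y - z)) (y - z)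
  (smooth_differentiable _ _ fs).
have dline t := is_derive_line _ _ _ _ _ _ _ (df t).
have [c] := MVT ltr01 (fun t _ => dline t)
  (derivable_within_continuous (fun t _ => @ex_derive _ _ _ _ _ _ _ (dline t))).
rewrite in_itv /= => /andP[c0 c1].
rewrite scale1r scale0r addr0 (addrC z) subrK subr0 mulr1 => ->.
rewrite derive_partial; last exact: smooth_differentiable.
rewrite (le_trans (ler_norm_sum _ _ _)) // mulr_suml ler_sum // => i _.
rewrite normrM mulrC ler_pM // ?ler_coord_norm //; apply: xr.
move: xy xz; rewrite -!ball_normE /= => xy xz.
have -> : x - (z + c *: (y - z)) = c *: (x - y) + (1 - c) *: (x - z).
  by apply/rowP => j; rewrite !mxE; ring.
rewrite (le_lt_trans (ler_normD _ _)) // !normrZ.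
rewrite !gtr0_norm ?subr_gt0 //.
by nra.
Qed.
End smooth.

(** * Truncation between two levels *)

(** Composing f with this function truncates |f| between the levels a and b and
    rescales the result to [0, 1], which yields the competitors for the
    capacity of {|f| > b}. *)
Definition ramp (R : realType) (a b s : R) : R :=
  Num.min 1 (Num.max 0 ((`|s| - a) / (b - a))).

Section ramp.
Context (R : realType) (a b : R) (ab : a < b).

Lemma ramp_lipschitz s t : `|ramp R a b s - ramp R a b t| <= (b - a)^-1 * `|s - t|.
Proof.
have max_lip (u v : R) : `|Num.max 0 u - Num.max 0 v| <= `|u - v|.
  have := ler_norm (v - u); rewrite (distrC v); have := ler_norm (u - v).
  by rewrite ler_norml; case: (leP 0 u); case: (leP 0 v) => *; apply/andP; split; lra.
have min_lip (u v : R) : `|Num.min 1 u - Num.min 1 v| <= `|u - v|.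
  have := ler_norm (v - u); rewrite (distrC v); have := ler_norm (u - v).
  by rewrite ler_norml; case: (leP 1 u); case: (leP 1 v) => *; apply/andP; split; lra.
apply: (le_trans (min_lip _ _)); apply: (le_trans (max_lip _ _)).
rewrite -mulrBl opprB addrA subrK normrM mulrC.
have ba0 : 0 <= (b - a)^-1 by rewrite invr_ge0 subr_ge0 ltW.
by rewrite (ger0_norm ba0) ler_wpM2l // ler_dist_dist.
Qed.

Lemma ramp_ge0 s : 0 <= ramp R a b s.
Proof. by rewrite le_min ler01 le_max lexx. Qed.

Lemma ramp_le1 s : ramp R a b s <= 1.
Proof. by rewrite ge_min lexx. Qed.

Lemma ramp_eq0 s : (ramp R a b s == 0) = (`|s| <= a).
Proof.
have [sa|sa] := leP `|s| a; last first.
  by rewrite gt_eqF // lt_min ltr01 lt_max divr_gt0 ?orbT ?subr_gt0.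
rewrite /ramp max_l ?min_r ?eqxx //.
by rewrite ler_pdivrMr ?subr_gt0 // mul0r subr_le0.
Qed.

Lemma ramp_eq1 s : b <= `|s| -> ramp R a b s = 1.
Proof.
move=> bs; rewrite /ramp min_l // le_max ler_pdivlMr ?subr_gt0 //.
by rewrite mul1r lerB // orbT.
Qed.

Lemma ramp_mid s : a < `|s| < b -> ramp R a b s = (b - a)^-1 * (`|s| - a).
Proof.
move=> /andP[sa sb]; rewrite /ramp mulrC max_r ?min_r //.
  by rewrite mulrC ler_pdivrMr ?subr_gt0 // mul1r lerB // ltW.
by rewrite mulr_ge0 // ?invr_ge0 subr_ge0 ltW.
Qed.

End ramp.

Section capacity.
Context (R : realType) (n : nat).
Implicit Types (f : 'rV[R]_n -> R) (x : 'rV[R]_n).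

Lemma locally_lipschitz_comp f (phi : R -> R) (k : R) :
  (forall s t, `|phi s - phi t| <= k * `|s - t|) ->
  locally_lipschitz f -> locally_lipschitz (phi \o f).
Proof.
move=> phi_lip f_lip x; have [U xU Ulip] := f_lip x; exists U => //.
have Ux : U x by exact: nbhs_singleton xU.
have [M M0 fM] := pinfty_ex_gt0 Ulip.
apply: (@klipschitzW _ _ _ (`|k| * M)).
  exact: (@globally_properfilter _ _ (x, x)) (conj Ux Ux).
move=> [y z] Uyz /=; rewrite (le_trans (phi_lip _ _)) // -mulrA.
apply: le_trans (ler_wpM2l _ (fM (y, z) Uyz)) => //=.
by rewrite ler_wpM2r // ler_norm.
Qed.

Lemma sqnorm_grad_ge0 f x : 0 <= sqnorm_grad f x.
Proof. by apply: sumr_ge0 => i _; exact: sqr_ge0. Qed.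

Lemma sqnorm_gradE f x : differentiable f x ->
  sqnorm_grad f x = \sum_(i < n) partial i f x ^+ 2.
Proof.
move=> dfx; apply: eq_bigr => i _; rewrite /grad.
by case: asboolP => // _; rewrite mxE.
Qed.

(** Truncation localizes the energy to the shell between the two levels. Where
    a < |f x| < b, the truncation is an affine function of f or of - f near x.
    Elsewhere it attains at x its minimum 0 or its maximum 1, so its gradient
    vanishes as soon as it exists, even when x lies on a level set |f| = a or
    |f| = b. Where the truncation is not differentiable, the gradient is 0 by
    convention. The estimate therefore holds at every point. *)
Lemma sqnorm_grad_ramp_le f a b x : smooth f -> 0 <= a < b ->
  sqnorm_grad (ramp R a b \o f) x <=
    if a < `|f x| < b then (b - a) ^- 2 * sqnorm_grad f x else 0.
Proof.
move=> fs /andP[a0 ab].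
have [dh|ndh] := pselect (differentiable (ramp R a b \o f) x); last first.
  rewrite /sqnorm_grad big1 => [|i _]; last first.
    by rewrite /grad asboolF // mxE expr0n.
  case: ifP => // _; apply: mulr_ge0; last exact: sqnorm_grad_ge0.
  by rewrite invr_ge0 exprn_ge0 // subr_ge0 ltW.
rewrite sqnorm_gradE //; case: ifPn => [fab|].
  (* The sign of f is constant near x, so |f| = s * f there. *)
  pose s := Num.sg (f x).
  have fx0 : f x != 0.
    by rewrite -normr_gt0; case/andP: fab => [/(le_lt_trans a0)].
  have fE : \forall y \near x, (ramp R a b \o f) y =
      (((b - a)^-1 * s) *: f - cst ((b - a)^-1 * a)) y.
    have sfE : s * f x = `|f x| by rewrite normrEsg.
    have sfc : (s * f y) @[y --> x] --> s * f x.
      exact: (continuousM (@cst_continuous _ _ s x) (smooth_continuous _ _ f fs x)).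
    near=> y.
    have sfa : a < s * f y.
      near: y; apply: (cvgr_gt (s * f x)) => //.
      by rewrite sfE; case/andP: fab.
    have sfb : s * f y < b.
      near: y; apply: (cvgr_lt (s * f x)) => //.
      by rewrite sfE; case/andP: fab.
    have fyE : `|f y| = s * f y.
      by rewrite -[RHS]gtr0_norm ?(le_lt_trans a0) // normrM normr_sg fx0 mul1r.
    by rewrite /= ramp_mid ?fyE ?sfa // mulrBr mulrA.
  rewrite sqnorm_gradE; last exact: smooth_differentiable.
  rewrite mulr_sumr ler_sum // => i _.
  have df : derivable f x (delta_mx ord0 i).
    exact/diff_derivable/smooth_differentiable.
  rewrite /partial (near_eq_derive _ fE).
  rewrite deriveB; [|exact: derivableZ|exact: derivable_cst].
  rewrite derive_cst deriveZ // subr0 -[X in X ^+ 2]/(_ * _).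
  by rewrite !exprMn sqr_sg fx0 mulr1 exprVn.
move=> nfab; rewrite big1 // => i _.
suff -> : partial i (ramp R a b \o f) x = 0 by rewrite expr0n.
have [fa|fa] := leP `|f x| a.
  have /eqP h0 : ramp R a b (f x) == 0 by rewrite ramp_eq0.
  by apply: derive_min => // y /=; rewrite h0 ramp_ge0.
have fb : b <= `|f x| by move: nfab; rewrite fa /= -leNgt.
by apply: derive_max => // y /=; rewrite (ramp_eq1 _ _ _ _ _ fb) ?ramp_le1.
Unshelve. all: by end_near. Qed.

End capacity.

(** * Capacity of superlevel sets *)

Local Open Scope ereal_scope.

(** The integral of a nonnegative function is a supremum over the simple
    functions below it, hence monotone without any measurability. The integrand that
    contains F and the gradient of a truncation are compared in this way with
    functions that are clearly measurable. *)
Lemma ge0_le_integral_nonmeasurable d (T : measurableType d) (R : realType)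
    (mu : {measure set T -> \bar R}) (f g : T -> \bar R) :
  (forall x, 0 <= f x) -> (forall x, f x <= g x) ->
  \int[mu]_x f x <= \int[mu]_x g x.
Proof.
move=> f0 fg; have g0 x : 0 <= g x := le_trans (f0 x) (fg x).
rewrite !ge0_integralTE //.
by apply: ereal_sup_le => _ [h hf <-]; exists h => // x; exact: le_trans (hf x) (fg x).
Qed.

Section borel.
Context (R : realType) (n : nat).
Implicit Types f : 'rV[R]_n -> R.

Lemma continuous_measurable_borelRn f : continuous f ->
  measurable_fun [set: borelRn R n] (f : borelRn R n -> R).
Proof.
move=> cf; apply: (measurability _ (RGenOpens.measurableE R)).
move=> _ [_ [a [b ->] <-]]; rewrite setTI; apply: sub_sigma_algebra.
by apply: open_comp; [move=> x _; exact: cf|exact: interval_open].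
Qed.

Lemma measurable_sqnorm_grad f : smooth f ->
  measurable_fun [set: borelRn R n] (sqnorm_grad f : borelRn R n -> R).
Proof.
move=> fs; rewrite (_ : sqnorm_grad f = fun x => (\sum_(i < n) partial i f x ^+ 2)%R).
  apply: measurable_sum => i; apply: measurable_funX.
  by apply: continuous_measurable_borelRn; exact: smooth_continuous_partial.
by apply/funext => x; rewrite sqnorm_gradE //; exact: smooth_differentiable.
Qed.

Lemma measurable_superlevel f (a : R) : continuous f ->
  measurable ([set x | (a < `|f x|)%R] : set (borelRn R n)).
Proof.
move=> cf; rewrite -[X in measurable X]setTI.
rewrite (_ : [set x | _] = (fun x => `|f x|%R) @^-1` `]a, +oo[%classic); last first.
  by apply/seteqP; split => x /=; rewrite in_itv /= andbT.
apply: (measurableT_comp (normr_measurable (D := setT))) => //.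
exact: continuous_measurable_borelRn.
Qed.

(** The truncation of f between the levels a and b is admissible for the
    capacity of {|f| > b}: it vanishes exactly on {|f| <= a}, which has measure
    at least 1/2. Its energy is concentrated on the shell a < |f| <= b. *)
Lemma capacity_superlevel_le (mu : probability (borelRn R n) R) f (a b : R) :
  smooth f -> (0 <= a < b)%R ->
  mu [set x | (a < `|f x|)%R] <= (2^-1)%:E ->
  capacity mu [set x | (b < `|f x|)%R] <=
    ((b - a) ^- 2)%:E *
    \int[mu]_(x in [set x | (a < `|f x| <= b)%R]) (sqnorm_grad f x)%:E.
Proof.
move=> fs /[dup] ab /andP[a0 ltab] mua.
have cf := smooth_continuous _ _ f fs.
have mT : measurable ([set x | (a < `|f x| <= b)%R] : set (borelRn R n)).
  rewrite (_ : [set x | _] = [set x | (a < `|f x|)%R] `\` [set x | (b < `|f x|)%R]).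
    by apply: measurableD; exact: measurable_superlevel.
  apply/seteqP; split => x /=.
    by move=> /andP[-> xb]; split => //; apply/negP; rewrite -leNgt.
  by move=> [-> /negP]; rewrite -leNgt.
have /measurable_EFinP mg := measurable_sqnorm_grad f fs.
rewrite -ge0_integralZl_EFin //; last 3 first.
- by move=> x _; rewrite lee_fin sqnorm_grad_ge0.
- exact: measurable_funTS.
- by rewrite invr_ge0 exprn_ge0 // subr_ge0 ltW.
rewrite integral_mkcond; apply: ge_ereal_inf.
exists (\int[mu]_x (sqnorm_grad (ramp R a b \o f) x)%:E).
  exists (ramp R a b \o f); split => //.
  - exact: (locally_lipschitz_comp _ _ f _ _ (ramp_lipschitz R a b ltab)
      (locally_lipschitz_smooth _ _ f fs)).
  - by move=> x /= bx; rewrite ramp_eq1 // ltW.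
  - rewrite (_ : [set x | _] = ~` [set x | (a < `|f x|)%R]); last first.
      apply/seteqP; split=> x /=.
        by move=> /eqP; rewrite ramp_eq0 // leNgt => /negP.
      by move=> /negP; rewrite -leNgt -(ramp_eq0 _ _ _ ltab) => /eqP.
    rewrite probability_setC; last exact: measurable_superlevel.
    case: (mu _) mua => [m|//|_]; last by rewrite -[leRHS]/+oo leey.
    by rewrite -EFinB !lee_fin => mh; lra.
apply: ge0_le_integral_nonmeasurable => x; first by rewrite lee_fin sqnorm_grad_ge0.
rewrite patchE; have := sqnorm_grad_ramp_le _ _ f a b x fs ab.
case: ifPn => [fab|_] hx.
  by rewrite mem_set /= ?lee_fin //; case/andP: fab => -> /ltW ->.
case: ifP => _; last by rewrite lee_fin.
rewrite lee_fin (le_trans hx) // mulr_ge0 ?sqnorm_grad_ge0 //.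
by rewrite invr_ge0 exprn_ge0 // subr_ge0 ltW.
Qed.

Lemma markov_superlevel (mu : probability (borelRn R n) R) f (S a : R) :
  continuous f -> (0 < a)%R -> \int[mu]_x (f x ^+ 2)%:E = S%:E ->
  mu [set x | (a < `|f x|)%R] <= (S / a ^+ 2)%:E.
Proof.
move=> cf a0 SE; have mA := measurable_superlevel f a cf.
have /measurable_EFinP mf2 : measurable_fun [set: borelRn R n] (fun x : borelRn R n => (f x ^+ 2)%R).
  apply: measurable_funX; exact: continuous_measurable_borelRn.
have : (a ^+ 2)%:E * mu [set x | (a < `|f x|)%R] <= S%:E.
  rewrite -SE -integral_cst //.
  apply: (@le_trans _ _ (\int[mu]_(x in [set x | (a < `|f x|)%R]) (f x ^+ 2)%:E)).
    apply: ge0_le_integral => //.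
    - by move=> x _; rewrite lee_fin sqr_ge0.
    - exact: measurable_funTS.
    - move=> x /= ax; rewrite lee_fin -(real_normK (num_real (f x))).
      by rewrite ler_sqr ?nnegrE ?ltW // (lt_trans a0).
  by apply: ge0_subset_integral => // x _; rewrite lee_fin sqr_ge0.
rewrite -(fineK (fin_num_measure mu _ mA)) -EFinM !lee_fin => h.
by rewrite ler_pdivlMr ?exprn_gt0 // mulrC.
Qed.

End borel.

(** * Geometric levels *)

(** Bernoulli's inequality and the archimedean property. *)
Lemma exists_lt_exprn (R : realType) (q y : R) : (1 < q)%R ->
  exists k : nat, (y < q ^+ k)%R.
Proof.
move=> q1; have q10 : (0 < q - 1)%R by rewrite subr_gt0.
have bernoulli k : (k%:R * (q - 1) < q ^+ k)%R.
  elim: k => [|k IH]; first by rewrite mul0r expr0.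
  have qk : (1 <= q ^+ k)%R by rewrite exprn_ege1 // ltW.
  by rewrite exprS -natr1; nra.
exists (Num.bound (`|y| / (q - 1))%R); apply: (lt_trans _ (bernoulli _)).
rewrite -ltr_pdivrMr //; apply: (@le_lt_trans _ _ (`|y| / (q - 1))%R).
  by rewrite ler_wpM2r ?ler_norm // invr_ge0 ltW.
by rewrite archi_boundP // divr_ge0 // ltW.
Qed.

(** The levels of |f|. They are chosen so that their squares 2 S rho ^+ j are
    geometric and so that, when S is the integral of f ^+ 2, Markov's inequality
    gives superlevel sets of measure at most (2 rho ^+ j)^-1. *)
Definition level (R : realType) (S rho : R) (j : nat) : R :=
  (Num.sqrt (2 * S) * Num.sqrt rho ^+ j)%R.

Section levels.
Context (R : realType) (S rho : R) (S_gt0 : (0 < S)%R) (rho_gt1 : (1 < rho)%R).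

Let sqrt_rho_gt1 : (1 < Num.sqrt rho)%R.
Proof. by rewrite -[X in (X < _)%R]sqrtr1 ltr_sqrt // (lt_trans ltr01). Qed.

Lemma level_gt0 j : (0 < level R S rho j)%R.
Proof.
rewrite mulr_gt0 ?sqrtr_gt0 ?mulr_gt0 // exprn_gt0 //.
exact: lt_trans sqrt_rho_gt1.
Qed.

Lemma level_sqr j : (level R S rho j ^+ 2 = 2 * S * rho ^+ j)%R.
Proof.
rewrite exprMn exprAC !sqr_sqrtr //; first by rewrite ltW // (lt_trans ltr01).
by rewrite ltW // mulr_gt0.
Qed.

Lemma levelS_sub j :
  (level R S rho j.+1 - level R S rho j = level R S rho j * (Num.sqrt rho - 1))%R.
Proof. by rewrite /level exprS; ring. Qed.

Lemma level_lt j : (level R S rho j < level R S rho j.+1)%R.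
Proof. by rewrite -subr_gt0 levelS_sub mulr_gt0 ?level_gt0 ?subr_gt0. Qed.

Lemma level_le i j : (i <= j)%N -> (level R S rho i <= level R S rho j)%R.
Proof.
by apply: (homo_leq (r := fun x y => (x <= y)%R)) => // [y x z|k];
  [exact: le_trans|rewrite ltW ?level_lt].
Qed.

Lemma between_levels y : (level R S rho 1 < y)%R ->
  exists j, (level R S rho j.+1 < y <= level R S rho j.+2)%R.
Proof.
move=> y1; have c0 : (0 < Num.sqrt (2 * S))%R by rewrite sqrtr_gt0 mulr_gt0.
have ex : exists k, (y <= level R S rho k)%R.
  have [k yk] := exists_lt_exprn R _ (y / Num.sqrt (2 * S))%R sqrt_rho_gt1.
  by exists k; rewrite ltW // /level mulrC -ltr_pdivrMr.
case: (ex_minnP ex) => -[|[|j]] yj minj; last first.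
- exists j; rewrite yj andbT ltNge; apply/negP => /minj; by rewrite ltnn.
- by move: yj; rewrite leNgt y1.
- by move: (le_trans yj (level_le 0 1 isT)); rewrite leNgt y1.
Qed.

End levels.

(** * The estimate on one shell *)

Section shell.
Context (R : realType) (n : nat) (D rho : R) (F : R -> R)
    (mu : probability (borelRn R n) R)
    (D_gt0 : (0 < D)%R) (rho_gt1 : (1 < rho)%R)
    (F_nondecreasing : forall x y : R, (0 <= x)%R -> (x <= y)%R -> (F x <= F y)%R)
    (mu_cap : forall A : set (borelRn R n), measurable A ->
      mu A <= ((2 * rho)^-1)%:E ->
      mu A * (F (rho / fine (mu A)))%:E <= D%:E * capacity mu A)
    (f : 'rV[R]_n -> R) (f_smooth : smooth f)
    (S : R) (S_gt0 : (0 < S)%R) (SE : \int[mu]_x (f x ^+ 2)%:E = S%:E).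

Let u := level R S rho.
Let rho_gt0 : (0 < rho)%R. Proof. exact: lt_trans rho_gt1. Qed.

Lemma measure_superlevel_le j :
  mu [set x | (u j < `|f x|)%R] <= ((2 * rho ^+ j)^-1)%:E.
Proof.
have cf := smooth_continuous _ _ f f_smooth.
have := markov_superlevel _ _ mu f S (u j) cf (level_gt0 _ _ _ S_gt0 rho_gt1 j) SE.
rewrite level_sqr //; congr (_ <= _%:E).
have rj : (rho ^+ j != 0)%R by rewrite expf_neq0 // gt_eqF.
by field; rewrite rj gt_eqF.
Qed.

(** Let m be the measure of the j.+1-th superlevel set. If m > 0, Markov's inequality gives
    2 rho ^+ j.+2 <= rho / m, so the left-hand side is at most
    2 S rho ^+ j.+2 * m F (rho / m), to which the capacity hypothesis applies.
    The capacity is bounded by the energy on the shell divided by the squared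
    gap 2 S rho ^+ j (sqrt rho - 1) ^+ 2 between consecutive levels, which
    leaves the factor rho ^+ 2 / (sqrt rho - 1) ^+ 2, free of j. *)
Lemma shell_le j :
  (2 * S * rho ^+ j.+2 * F (2 * rho ^+ j.+2))%:E *
    mu [set x | (u j.+1 < `|f x|)%R] <=
  (D * (rho / (Num.sqrt rho - 1)) ^+ 2)%:E *
    \int[mu]_(x in [set x | (u j < `|f x| <= u j.+1)%R]) (sqnorm_grad f x)%:E.
Proof.
have cf := smooth_continuous _ _ f f_smooth.
set Om := [set x | (u j.+1 < `|f x|)%R].
have mOm : measurable (Om : set (borelRn R n)) by exact: measurable_superlevel.
set I := \int[mu]_(x in _) _.
have rj k : (1 <= rho ^+ k)%R by rewrite exprn_ege1 // ltW.
have rj0 k : (0 < rho ^+ k)%R by rewrite exprn_gt0.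
have q1 : (0 < Num.sqrt rho - 1)%R.
  by rewrite subr_gt0 -[X in (X < _)%R]sqrtr1 ltr_sqrt.
have muOm : mu Om <= ((2 * rho ^+ j.+1)^-1)%:E by exact: measure_superlevel_le.
have cap : capacity mu Om <= ((u j.+1 - u j) ^- 2)%:E * I.
  apply: capacity_superlevel_le => //.
    by rewrite ltW ?level_gt0 //= level_lt.
  apply: le_trans (measure_superlevel_le j) _; rewrite lee_fin.
  by rewrite lef_pV2 ?posrE ?mulr_gt0 // ler_peMr.
have -> : (D * (rho / (Num.sqrt rho - 1)) ^+ 2 =
    2 * S * rho ^+ j.+2 * D * (u j.+1 - u j) ^- 2)%R.
  rewrite (_ : (u j.+1 - u j) ^+ 2 = 2 * S * rho ^+ j * (Num.sqrt rho - 1) ^+ 2)%R; last first.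
    by rewrite /u levelS_sub exprMn level_sqr.
  rewrite 2!(exprS rho).
  by field; rewrite !gt_eqF //.
have c0 : (0 <= 2 * S * rho ^+ j.+2)%R.
  by apply: mulr_ge0; [rewrite mulr_ge0 // ltW|exact: ltW].
apply: (@le_trans _ _ ((2 * S * rho ^+ j.+2)%:E * (D%:E * capacity mu Om))); last first.
  rewrite muleA -EFinM [in leRHS]EFinM -muleA; apply: lee_wpmul2l => //.
  by rewrite lee_fin mulr_ge0 // ltW.
apply: le_trans (lee_wpmul2l _ (mu_cap _ mOm _)); last 2 first.
- by rewrite lee_fin.
- apply: le_trans muOm _; rewrite lee_fin lef_pV2 ?posrE ?mulr_gt0 //.
  by rewrite exprS ler_pM2l // ler_peMr // ltW.
rewrite EFinM -muleA; apply: lee_wpmul2l; first by rewrite lee_fin.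
rewrite muleC; move: muOm; rewrite -(fineK (fin_num_measure mu _ mOm)) /=.
set m := fine _; rewrite !lee_fin => muOm.
have m0 : (0 <= m)%R by rewrite fine_ge0.
(* At m = 0 the quotient rho / m is 0 and gives no bound, but both sides vanish. *)
have [->|mn0] := eqVneq m 0%R; first by rewrite !mul0r.
have {}m0 : (0 < m)%R by rewrite lt0r mn0.
rewrite ler_pM2l //; apply: F_nondecreasing; first by rewrite mulr_ge0 // ltW.
rewrite ler_pdivlMr // exprS.
rewrite (_ : (2 * (rho * rho ^+ j.+1) * m = rho * (m * (2 * rho ^+ j.+1)))%R); last by ring.
rewrite -[leRHS]mulr1 ler_pM2l // -ler_pdivlMr ?mul1r //.
by apply: mulr_gt0.
Qed.
End shell.

(** * The functional inequality *)

(* If \int f^2 dmu = +oo then fine sends it to 0, and division by 0 yields 0,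
   so the argument of F below is 0, i.e. f^2 / +oo. Likewise rho / 0 = 0 when
   mu A = 0, in which case the left-hand side of the hypothesis is 0. *)
Theorem theorem11 (R : realType) (n : nat) (D rho : R) (F : R -> R)
    (mu : probability (borelRn R n) R)
    (D_gt0 : (0 < D)%R) (rho_gt1 : (1 < rho)%R)
    (F_ge0 : forall x : R, (0 <= x)%R -> (0 <= F x)%R)
    (F_nondecreasing : forall x y : R, (0 <= x)%R -> (x <= y)%R -> (F x <= F y)%R)
    (F_eq0 : forall x : R, (0 <= x)%R -> (x <= 2 * rho)%R -> F x = 0%R)
    (mu_ac : mu `<< (@lebesgue_outer R n : set (borelRn R n) -> \bar R))
    (mu_cap : forall A : set (borelRn R n), measurable A ->
      mu A <= ((2 * rho)^-1)%:E ->
      mu A * (F (rho / fine (mu A)))%:E <= D%:E * capacity mu A)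
    (f : 'rV[R]_n -> R) (f_smooth : smooth f) :
  \int[mu]_x (f x ^+ 2 * F (f x ^+ 2 / fine (\int[mu]_y (f y ^+ 2)%:E)))%:E
    <= (D * (rho / (Num.sqrt rho - 1)) ^+ 2)%:E
       * \int[mu]_x (sqnorm_grad f x)%:E.
Proof.
have cf := smooth_continuous _ _ f f_smooth.
have rho_gt0 : (0 < rho)%R by exact: lt_trans rho_gt1.
have C_ge0 : (0 <= D * (rho / (Num.sqrt rho - 1)) ^+ 2)%R.
  by rewrite mulr_ge0 ?sqr_ge0 // ltW.
have G_ge0 x : 0 <= (sqnorm_grad f x)%:E by rewrite lee_fin sqnorm_grad_ge0.
have : 0 <= \int[mu]_y (f y ^+ 2)%:E.
  by apply: integral_ge0 => x _; rewrite lee_fin sqr_ge0.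
(* The integral of f ^+ 2 is 0 or infinite: the argument of F is then 0. *)
have degenerate : fine (\int[mu]_y (f y ^+ 2)%:E) = 0%R ->
  \int[mu]_x (f x ^+ 2 * F (f x ^+ 2 / fine (\int[mu]_y (f y ^+ 2)%:E)))%:E
    <= (D * (rho / (Num.sqrt rho - 1)) ^+ 2)%:E
       * \int[mu]_x (sqnorm_grad f x)%:E.
  move=> ->; rewrite integral0_eq => [|x _].
    by rewrite mule_ge0 ?lee_fin // integral_ge0.
  by rewrite invr0 mulr0 F_eq0 ?mulr0 // mulr_ge0 // ltW.
case SE: (\int[mu]_y (f y ^+ 2)%:E) degenerate => [S||] //= degenerate; last first.
  by move=> _; exact: degenerate.
rewrite lee_fin le_eqVlt => /predU1P[S0|S_gt0]; first exact: degenerate.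
move=> {degenerate}.
pose Om j : set (borelRn R n) := [set x | (level R S rho j < `|f x|)%R].
have mOm j : measurable (Om j) by exact: measurable_superlevel.
pose c j := (2 * S * rho ^+ j.+2 * F (2 * rho ^+ j.+2))%R.
have rho_ge0 j : (0 <= rho ^+ j)%R by rewrite exprn_ge0 // ltW.
have c_ge0 j : (0 <= c j)%R.
  rewrite /c; apply: mulr_ge0; last by rewrite F_ge0 // mulr_ge0.
  by rewrite mulr_ge0 // mulr_ge0 // ltW.
have term_ge0 j x : 0 <= (c j)%:E * (\1_(Om j.+1) x)%:E.
  by rewrite -EFinM lee_fin mulr_ge0.
(* Where f ^+ 2 > 2 rho S, the value |f x| lies between the levels j.+1 and j.+2
   for some j; bounding f ^+ 2 by the square of the upper one bounds the
   integrand by the j-th term. Elsewhere the integrand is 0. *)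
apply: (@le_trans _ _ (\int[mu]_x (\sum_(j <oo) ((c j)%:E * (\1_(Om j.+1) x)%:E)))).
  apply: ge0_le_integral_nonmeasurable => x.
    by rewrite lee_fin mulr_ge0 ?sqr_ge0 // F_ge0 // divr_ge0 ?sqr_ge0 // ltW.
  have fS_ge0 : (0 <= f x ^+ 2 / S)%R by rewrite divr_ge0 ?sqr_ge0 // ltW.
  have [small|large] := leP (f x ^+ 2 / S)%R (2 * rho)%R.
    by rewrite F_eq0 // mulr0 nneseries_ge0.
  have abs_sqr : (f x ^+ 2 = `|f x| ^+ 2)%R by rewrite real_normK ?num_real.
  have above1 : (level R S rho 1 < `|f x|)%R.
    rewrite -(ltr_pXn2r (n := 2)) ?nnegrE // ?ltW ?level_gt0 //.
    rewrite level_sqr // expr1 -abs_sqr.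
    by move: large; rewrite ltr_pdivlMr //; lra.
  have [j /andP[jf fj]] := between_levels _ _ _ S_gt0 rho_gt1 _ above1.
  have fle : (f x ^+ 2 <= 2 * S * rho ^+ j.+2)%R.
    rewrite -level_sqr // abs_sqr ler_sqr ?nnegrE //.
    by rewrite ltW // level_gt0.
  apply: (@le_trans _ _ ((c j)%:E * (\1_(Om j.+1) x)%:E)).
    rewrite indicE mem_set // mule1 lee_fin ler_pM ?sqr_ge0 ?F_ge0 //.
    apply: F_nondecreasing => //.
    by rewrite ler_pdivrMr // mulrAC.
  apply: le_trans (nneseries_lim_ge j.+1 _) => //.
  by rewrite big_nat_recr //= leeDr // sume_ge0.
rewrite integral_nneseries //; last first.
  move=> j; apply: measurable_funeM; apply/measurable_EFinP.
  exact: measurable_indic.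
(* The energies of the shells add up to at most the total energy because the
   shells are disjoint. *)
pose T j : set (borelRn R n) :=
  [set x | (level R S rho j < `|f x| <= level R S rho j.+1)%R].
have mT j : measurable (T j).
  rewrite (_ : T j = Om j `\` Om j.+1); first by apply: measurableD.
  apply/seteqP; split => x /=.
    by move=> /andP[? xb]; split => //; apply/negP; rewrite -leNgt.
  by move=> [? /negP]; rewrite /T /= -leNgt => ->; rewrite andbT.
have tT : trivIset setT T.
  apply: ltn_trivIset => i j ij.
  rewrite -subset0 => x [/andP[_ xi] /andP[jx _]].
  have := level_le R S rho S_gt0 rho_gt1 _ _ ij.
  by move=> /(le_trans xi); rewrite leNgt jx.
have /measurable_EFinP mG := measurable_sqnorm_grad R n f f_smooth.
apply: (@le_trans _ _ ((D * (rho / (Num.sqrt rho - 1)) ^+ 2)%:E *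
    \int[mu]_(x in \bigcup_j T j) (sqnorm_grad f x)%:E)); last first.
  apply: lee_wpmul2l; first by rewrite lee_fin.
  by apply: ge0_subset_integral => //; exact: bigcupT_measurable.
rewrite ge0_integral_bigcup //; last exact: measurable_funTS.
rewrite -nneseriesZl => [|j _]; last by apply: integral_ge0.
apply: lee_nneseries => [j _ _|j _]; first exact: integral_ge0.
rewrite ge0_integralZl_EFin //; last 1 first.
  by apply/measurable_EFinP; exact: measurable_indic.
rewrite integral_indic // setIT.
exact: (shell_le _ _ _ _ F mu D_gt0 rho_gt1 F_nondecreasing mu_cap).
Qed.
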